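(* Let $u\in C^4_{\mathrm{per}}(\Omega)$ be a classical steady-state solution of the thin film equation $$u_t+\bigl(u^n(u_{\theta\theta\theta}+u_\theta-\sin\theta)+\omega u\bigr)_\theta=0$$ with $n>1$, that is, a non-negative, time-independent function $u(\theta)$ satisfying $$\bigl(u^n(u_{\theta\theta\theta}+u_\theta-\sin\theta)+\omega u\bigr)_\theta=0\quad\text{on }\Omega .$$ If $\operatorname{supp}(u)\neq\Omega$, where $\operatorname{supp}(u)=\{\theta\in\Omega:u(\theta)>0\}$, then $\omega=0$.
   Context: $\Omega=[-\pi,\pi)$, regarded as one period of the circle. $C^k_{\mathrm{per}}(\Omega)$ is the set of continuous $2\pi$-periodic functions on $\Omega$ with $k$ continuous derivatives; functions are real-valued. The exponent $n$ is a real number and $\omega$ is a real constant (rotation parameter). Steady-state solutions are by definition non-negative and time independent.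
   Formalization: The formal theorem assumes in addition that u is not identically zero; without this the claim is false, since u = 0 is a classical steady state for every ω and its support is empty, hence different from Ω. *)

(* Defs.v *)
From HB Require Import structures.
From mathcomp Require Import all_boot all_order all_algebra.
From mathcomp Require Import all_classical all_reals all_analysis.

Set Implicit Arguments.
Unset Strict Implicit.
Unset Printing Implicit Defensive.

Import Order.TTheory GRing.Theory Num.Theory.
Import numFieldNormedType.Exports.

Local Open Scope ring_scope.
Local Open Scope classical_set_scope.

(* Functions on the circle are represented by 2pi-periodic functions on the
   whole line, so that derivatives at -pi are the usual two-sided ones. *)
Definition Omega (R : realType) : set R := `[- pi, pi[.
Arguments Omega : clear implicits.

(* [derive1n] is total, so the existence of each derivative up to order [k]
   has to be asserted separately. *)
Definition Cper (R : realType) (k : nat) (u : R -> R) : Prop :=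
  [/\ periodic u (pi *+ 2),
      forall j, (j < k)%N -> forall theta, derivable (derive1n j u) theta 1 &
      forall j, (j <= k)%N -> continuous (derive1n j u)].

Definition supp (R : realType) (u : R -> R) : set R :=
  [set theta | Omega R theta /\ 0 < u theta].

(* For [n <> 0], [0 `^ n = 0]. *)
Definition flux (R : realType) (n omega : R) (u : R -> R) (theta : R) : R :=
  (u theta) `^ n * (derive1n 3 u theta + derive1n 1 u theta - sin theta)
  + omega * u theta.

Definition classical_steady_state (R : realType) (n omega : R) (u : R -> R) :
    Prop :=
  [/\ Cper 4 u,
      forall theta, Omega R theta -> 0 <= u theta &
      forall theta, Omega R theta -> is_derive theta 1 (flux n omega u) 0].

(* Main.v *)
Require Import Defs.
From mathcomp Require Import all_boot all_order all_algebra.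
From mathcomp Require Import all_classical all_reals all_analysis.
From mathcomp Require Import lra.
Import Order.TTheory GRing.Theory Num.Theory.
Import numFieldNormedType.Exports.
Local Open Scope ring_scope.
Local Open Scope classical_set_scope.

(** Since the derivative of the flux vanishes on one period, the flux is
    constant there ([is_derive_0_cst_itv]); it is zero where [u] is, because
    [u `^ n] and [omega * u] both are, so it is zero on the whole of [Omega].
    As [u >= 0], the flux is [u * g] ([flux_factor]) with
    [g = u `^ (n - 1) * (u''' + u' - sin) + omega].  Hence [g = 0] wherever
    [u > 0].  Because [n > 1], the factor [u `^ (n - 1)] is continuous across
    the zeros of [u] and vanishes there ([continuous_powR_comp]), so [g] is
    continuous and equals [omega] wherever [u = 0].  Thus [g] takes on [Omega]
    no values but [0] and [omega].  It takes both, since [u] has a zero in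
    [Omega] and, being nontrivial and periodic, a positive value there too.
    A continuous function on an interval cannot jump from one value to the
    other ([continuous_two_values]), so [omega = 0]. *)

(** Periodicity is what connects the two domains at play: it extends [u >= 0]
    from one period to the line, where continuity is used, and moves a point
    with [u <> 0] from the line into the period. *)
Lemma Omega_representative {R : realType} {f : R -> R} (x : R) :
  periodic f (pi *+ 2) -> exists2 y, Omega R y & f x = f y.
Proof.
move=> perf; have pi0 : 0 < (pi : R) by exact: pi_gt0.
have T0 : 0 < (pi : R) *+ 2 by rewrite mulrn_wgt0.
set k := Num.floor ((x + pi) / (pi *+ 2)).
exists (x - k%:~R * (pi *+ 2)).
  have := floor_itv ((x + pi) / (pi *+ 2)).
  rewrite -/k ler_pdivlMr// ltr_pdivrMr// intrD /Omega /= in_itv /=.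
  by move=> /andP[kl ku]; apply/andP; split; lra.
rewrite mulrzl; case: k => m; last first.
  by rewrite NegzE mulrNz opprK -[_ *~ _]/(_ *+ _) (periodicn perf).
by rewrite -[in LHS](subrK (pi *+ 2 *~ m) x) (periodicn perf).
Qed.

Lemma is_derive_0_cst_itv {R : realType} {i : interval R} {f : R -> R} :
  {in i, forall x : R, is_derive x 1 f 0} -> {in i &, forall x y, f x = f y}.
Proof.
move=> df; suff key x y : x \in i -> y \in i -> x <= y -> f x = f y.
  move=> x y xi yi; have [/key|/ltW yx] := leP x y; first exact.
  by symmetry; exact: key.
move=> xi yi xy; have sub z : z \in `[x, y]%R -> z \in i.
  by rewrite in_itv => zxy; exact: (interval_is_interval xi yi).
have cf : {within `[x, y], continuous f}.
  apply: derivable_within_continuous => z /sub zi.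
  by have [] := df z zi.
have dfo z : z \in `]x, y[%R -> is_derive z 1 f 0.
  by move=> /subset_itv_oo_cc zi; exact/df/sub.
have [c _ /eqP] := MVT_segment xy dfo cf.
by rewrite mul0r subr_eq0 => /eqP.
Qed.

(** At a positive value of [u] this is the differentiability of the power
    function.  At a zero of [u] that fails, and for negative bases [powR] does
    not tend to [0 `^ p] either; this is where [u >= 0] and [0 < p] come in. *)
Lemma continuous_powR_comp {R : realType} {T : topologicalType} (p : R)
    (u : T -> R) :
  0 < p -> (forall x, 0 <= u x) -> continuous u ->
  continuous (fun x => u x `^ p).
Proof.
move=> p0 u0 cu x; have := u0 x; rewrite le_eqVlt => /predU1P[ux|ux].
  rewrite /continuous_at -ux powR0 ?gt_eqF//; apply/cvgrPdist_lt => e e0.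
  (* The modulus of continuity of [a `^ p] at [0] is its inverse function. *)
  have d0 : 0 < e `^ p^-1 by exact: powR_gt0.
  have /cvgrPdist_lt/(_ _ d0) := cu x.
  apply: filterS => y; rewrite -ux !sub0r !normrN !ger0_norm ?powR_ge0// => uy.
  have -> : e = (e `^ p^-1) `^ p by rewrite -powRrM mulVf ?gt_eqF// powRr1// ltW.
  by apply: gt0_ltr_powR => //; rewrite nnegrE ?u0 ?ltW.
apply: (@continuous_comp _ _ _ u (fun a => a `^ p)); first exact: cu.
apply/differentiable_continuous/derivable1_diffP/derivable_powR.
by rewrite in_itv /= ux.
Qed.

Lemma continuous_two_values {R : realType} {i : interval R} {w : R}
    {g : R -> R} {x y : R} :
  continuous g -> {in i, forall z, g z = 0 \/ g z = w} ->
  x \in i -> y \in i -> g x = 0 -> g y = w -> w = 0.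
Proof.
move=> cg two xi yi gx gy.
have half z : z \in i -> g z = w / 2 -> w = 0 by move=> /two[] -> ?; lra.
have [xy|/ltW yx] := leP x y.
- have [c cxy gc] : exists2 c, c \in `[x, y]%R & g c = w / 2.
    apply: IVT => //; first exact: continuous_subspaceT.
    by rewrite gx gy; case: (leP 0 w) => ?; lra.
  apply: half gc; apply: (interval_is_interval xi yi).
  by move: cxy; rewrite in_itv.
- have [c cyx gc] : exists2 c, c \in `[y, x]%R & g c = w / 2.
    apply: IVT => //; first exact: continuous_subspaceT.
    by rewrite gx gy; case: (leP w 0) => ?; lra.
  apply: half gc; apply: (interval_is_interval yi xi).
  by move: cyx; rewrite in_itv.
Qed.

Lemma flux_factor {R : realType} (n omega : R) (u : R -> R) (x : R) :
  n != 0 -> 0 <= u x ->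
  flux n omega u x =
  u x * (u x `^ (n - 1) * (derive1n 3 u x + derive1n 1 u x - sin x) + omega).
Proof.
move=> n0 ux; rewrite /flux; have [->|ux0] := eqVneq (u x) 0.
  by rewrite powR0// !mul0r mulr0 addr0.
rewrite [RHS]mulrDr mulrA [u x * omega]mulrC -[X in X * _ `^ _](powRr1 ux).
by rewrite -powRD ?ux0 ?implybT// [1 + _]addrC subrK.
Qed.

Theorem proposition1 (R : realType) (n omega : R) (u : R -> R)
    (hn : 1 < n)
    (hu : classical_steady_state n omega u)
    (hu_nontrivial : exists theta : R, u theta <> 0)
    (hsupp : supp u <> Omega R) :
  omega = 0.
Proof.
case: hu => -[peru _ cu] u_ge0 dflux.
have u0 x : 0 <= u x.
  by have [y Oy ->] := Omega_representative x peru; exact: u_ge0.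
have [a Oa ua] : exists2 a, Omega R a & u a = 0.
  apply: contra_notP hsupp => nz; apply/seteqP; split=> x; first by case.
  move=> Ox; split=> //; rewrite lt_neqAle u0 andbT eq_sym.
  by apply/eqP => ux; apply: nz; exists x.
have [b Ob ub] : exists2 b, Omega R b & u b != 0.
  have [x /eqP ux] := hu_nontrivial.
  by have [b Ob uxb] := Omega_representative x peru; exists b; rewrite -?uxb.
have n1 : 0 < n - 1 by rewrite subr_gt0.
have n0 : n != 0 by rewrite gt_eqF// (lt_trans ltr01).
pose g x := u x `^ (n - 1) * (derive1n 3 u x + derive1n 1 u x - sin x) + omega.
have fluxE x : flux n omega u x = u x * g x by exact: flux_factor.
have ug0 x : Omega R x -> u x * g x = 0.
  move=> Ox; rewrite -fluxE.
  rewrite (is_derive_0_cst_itv (i := `[- pi, pi[%R) dflux x a Ox Oa).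
  by rewrite fluxE ua mul0r.
have gz x : u x = 0 -> g x = omega.
  by move=> ux; rewrite /g ux powR0 ?gt_eqF// mul0r add0r.
have gp x : Omega R x -> u x != 0 -> g x = 0.
  by move=> /ug0/eqP + ux; rewrite mulf_eq0 (negPf ux) => /eqP.
have cg : continuous g.
  move=> x; apply: cvgD; last exact: cvg_cst.
  apply: cvgM; first by apply: continuous_powR_comp => //; exact: (cu 0%N).
  apply: cvgB; last exact: continuous_sin.
  by apply: cvgD; [exact: (cu 3)|exact: (cu 1%N)].
apply: (continuous_two_values (i := `[- pi, pi[%R) cg _ Ob Oa (gp b Ob ub)).
  move=> x Ox; have [ux|ux] := eqVneq (u x) 0; first by right; exact: gz.
  by left; exact: gp.
exact: gz.
Qed.
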